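(* There exists a constant $c>0$, independent of $n$, such that for every $n\in\mathbb{N}$ there exists an $M_n$-valued function $b$ on $\mathbb{T}$ with $\|b\|_{L^\infty(M_n)}\le 1$ and $$\|\pi_b\|_{L^2(\ell_n^2)\to L^2(\ell_n^2)}\ \ge\ c\,\log(n+1).$$
   Context: $M_n$ is the algebra of complex $n\times n$ matrices with the operator norm, acting on $\ell_n^2=\mathbb{C}^n$ with its Euclidean norm. $\mathbb{T}$ is the unit circle with normalized Haar measure $dt$ and the usual dyadic filtration $(\mathcal{F}_k)_{k\ge 0}$ ($\mathcal{F}_k$ is generated by the $2^k$ dyadic arcs of equal measure $2^{-k}$). $L^\infty(M_n)$ is the space of essentially bounded measurable functions $\mathbb{T}\to M_n$ with norm $\operatorname{ess\,sup}_t\|b(t)\|_{M_n}$, and $L^2(\ell_n^2)$ is the space of square integrable functions $\mathbb{T}\to\ell_n^2$. $E_k f$ denotes the conditional expectation of a (vector- or matrix-valued) function $f$ with respect to $\mathcal{F}_k$, and $d_k b=E_k b-E_{k-1}b$ for $k\ge 1$. The matrix-valued dyadic paraproduct associated with $b$ is the operator $$\pi_b(f)=\sum_{k\ge 1}(d_k b)(E_{k-1}f),\qquad f\in L^2(\ell_n^2),$$ where the matrix $(d_kb)(t)$ is applied to the vector $(E_{k-1}f)(t)$ pointwise; $\|\pi_b\|_{L^2(\ell_n^2)\to L^2(\ell_n^2)}$ is its operator norm. *)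

(* Defs.v *)
From HB Require Import structures.
From mathcomp Require Import all_boot all_order all_algebra.
From mathcomp Require Import all_classical all_reals all_analysis.
From mathcomp Require Import measurable_realfun ess_sup_inf hoelder complex.

Set Implicit Arguments.
Unset Strict Implicit.
Unset Printing Implicit Defensive.

Import Order.TTheory GRing.Theory Num.Theory.
Import numFieldNormedType.Exports.
Import ComplexField.Normc.

Local Open Scope classical_set_scope.
Local Open Scope ring_scope.
Local Open Scope complex_scope.

Record circle (R : realType) : Type :=
  Circle { circle_val : R[i]; circle_valP : normc circle_val == 1 }.

HB.instance Definition _ (R : realType) := [isSub for @circle_val R].
HB.instance Definition _ (R : realType) := [Choice of circle R by <:].

Lemma normc_cos_sin (R : realType) (a : R) : normc (cos a +i* sin a) == 1.
Proof. by rewrite /normc cos2Dsin2 sqrtr1. Qed.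

Definition circle_exp (R : realType) (t : R) : circle R :=
  Circle (normc_cos_sin (2 * pi * t)).

HB.instance Definition _ (R : realType) :=
  isPointed.Build (circle R) (circle_exp 0).

Definition circle_coord (R : realType) (z : circle R) : R * R :=
  (complex.Re (circle_val z), complex.Im (circle_val z)).

(* The Borel sets of the circle: the traces of the Borel sets of the plane. *)
Definition circle_measurable (R : realType) : set (set (circle R)) :=
  preimage_set_system setT (@circle_coord R) measurable.

Lemma sigma_algebra_circle (R : realType) :
  sigma_algebra setT (@circle_measurable R).
Proof. exact/sigma_algebra_preimage/sigma_algebra_measurable. Qed.

Lemma circle_measurable0 (R : realType) : @circle_measurable R set0.
Proof. by case: (@sigma_algebra_circle R). Qed.

Lemma circle_measurableC (R : realType) (A : set (circle R)) :
  circle_measurable A -> circle_measurable (~` A).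
Proof. by rewrite -setTD; case: (@sigma_algebra_circle R) => _ + _; exact. Qed.

Lemma circle_measurable_bigcup (R : realType) (F : (set (circle R))^nat) :
  (forall i, circle_measurable (F i)) -> circle_measurable (\bigcup_i F i).
Proof. by case: (@sigma_algebra_circle R) => _ _; exact. Qed.

HB.instance Definition _ (R : realType) :=
  isMeasurable.Build (preimage_display (@circle_coord R)) (circle R)
    (@circle_measurable0 R) (@circle_measurableC R)
    (@circle_measurable_bigcup R).

Lemma measurable_circle_exp (R : realType) :
  measurable_fun [set: measurableTypeR R]
    (@circle_exp R : measurableTypeR R -> circle R).
Proof.
have mc : measurable_fun [set: R] (@circle_coord R \o @circle_exp R).
  apply/measurable_fun_pairP; split; apply: continuous_measurable_fun => t /=.
    by apply: (@continuous_comp _ _ _ (fun t => 2 * pi * t) cos);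
      [exact: mulrl_continuous|exact: continuous_cos].
  by apply: (@continuous_comp _ _ _ (fun t => 2 * pi * t) sin);
    [exact: mulrl_continuous|exact: continuous_sin].
by move=> _ _ [B mB <-]; rewrite setTI setTI -[X in measurable X]setTI; exact: mc.
Qed.

Definition circle_exp_mfun (R : realType) :
    {mfun measurableTypeR R >-> circle R} :=
  @mfun_Sub _ _ (measurableTypeR R) (circle R) (@circle_exp R)
    (mem_set (@measurable_circle_exp R)).

(* The normalized Haar measure: the law of exp(2 pi i U), with U uniform on
   [0, 1]. *)
Definition haar (R : realType) : probability (circle R) R :=
  distribution (uniform_prob (@ltr01 R)) (circle_exp_mfun R).

Definition dyadic_arc (R : realType) (k j : nat) : set (circle R) :=
  [set circle_exp t | t in `[j%:R / 2 ^+ k, j.+1%:R / 2 ^+ k[].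

Definition dyadic_filtration (R : realType) (k : nat) : set (set (circle R)) :=
  <<s [set dyadic_arc k j | j in [set j | (j < 2 ^ k)%N]] >>.

Definition is_condexp (R : realType) (G : set (set (circle R)))
    (f g : circle R -> R) : Prop :=
  [/\ forall B : set R, measurable B -> G (g @^-1` B),
      (haar R).-integrable setT (EFin \o g)
    & forall A, G A ->
        \int[haar R]_(t in A) g t = \int[haar R]_(t in A) f t].

(* The integrable functions used below do have a conditional expectation, and it
   is unique pointwise for the dyadic filtration, whose atoms have positive
   measure: neither the choice of a version nor the default value matters. *)
Definition condexp (R : realType) (G : set (set (circle R)))
    (f : circle R -> R) : circle R -> R :=
  xget (fun=> 0) [set g | is_condexp G f g].

Definition mx_measurable (R : realType) (m n : nat)
    (f : circle R -> 'M[R[i]]_(m, n)) : Prop :=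
  forall i j, measurable_fun setT (fun t => complex.Re (f t i j)) /\
              measurable_fun setT (fun t => complex.Im (f t i j)).

Definition dyadic_E (R : realType) (m n k : nat)
    (f : circle R -> 'M[R[i]]_(m, n)) (t : circle R) : 'M[R[i]]_(m, n) :=
  \matrix_(i, j)
    (condexp (dyadic_filtration k) (fun s => complex.Re (f s i j)) t +i*
     condexp (dyadic_filtration k) (fun s => complex.Im (f s i j)) t).

(* Meaningful for k >= 1 only. *)
Definition dyadic_d (R : realType) (m n k : nat)
    (f : circle R -> 'M[R[i]]_(m, n)) (t : circle R) : 'M[R[i]]_(m, n) :=
  dyadic_E k f t - dyadic_E k.-1 f t.

Definition vnorm (R : realType) (n : nat) (v : 'cV[R[i]]_n) : R :=
  Num.sqrt (\sum_(i < n) normc (v i 0) ^+ 2).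

Definition mx_opnorm (R : realType) (n : nat) (A : 'M[R[i]]_n) : R :=
  sup [set vnorm (A *m v) | v in [set v : 'cV[R[i]]_n | vnorm v <= 1]].

Definition Linfty_norm (R : realType) (n : nat)
    (b : circle R -> 'M[R[i]]_n) : \bar R :=
  ess_sup (haar R) (fun t => (mx_opnorm (b t))%:E).

Definition L2_norm (R : realType) (n : nat)
    (f : circle R -> 'cV[R[i]]_n) : \bar R :=
  Lnorm (haar R) 2%:E (fun t => (vnorm (f t))%:E).

Definition in_L2 (R : realType) (n : nat)
    (f : circle R -> 'cV[R[i]]_n) : Prop :=
  mx_measurable f /\ (L2_norm f < +oo)%E.

Definition paraproduct_sum (R : realType) (n : nat)
    (b : circle R -> 'M[R[i]]_n) (f : circle R -> 'cV[R[i]]_n) (N : nat)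
    (t : circle R) : 'cV[R[i]]_n :=
  \sum_(1 <= k < N.+1) dyadic_d k b t *m dyadic_E k.-1 f t.

(* The sum of the series in L2; for essentially bounded b and f in L2 it
   converges, to a limit which is unique almost everywhere. *)
Definition paraproduct (R : realType) (n : nat)
    (b : circle R -> 'M[R[i]]_n) (f : circle R -> 'cV[R[i]]_n) :
    circle R -> 'cV[R[i]]_n :=
  xget (fun=> 0) [set h | in_L2 h /\
    (fun N => L2_norm (fun t => paraproduct_sum b f N t - h t)) @ \oo --> 0%E].

Definition L2_opnorm (R : realType) (n : nat)
    (P : (circle R -> 'cV[R[i]]_n) -> (circle R -> 'cV[R[i]]_n)) : \bar R :=
  ereal_sup [set L2_norm (P f) | f in [set f | in_L2 f /\ (L2_norm f <= 1)%E]].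

(* Main.v *)
Require Import Defs.
From mathcomp Require Import all_boot all_order all_algebra.
From mathcomp Require Import all_classical all_reals all_analysis.
From mathcomp Require Import complex.
From mathcomp Require Import measurable_realfun ess_sup_inf.
From mathcomp Require Import ring lra zify.

(** Multiplying the rows and the columns of a matrix by signs does not change
    its operator norm, but a paraproduct sees the order in which these signs are
    revealed.  Let [A] be a real matrix and [b = D A D'], where [D] and [D'] are
    diagonal matrices of Rademacher functions, revealed in the order
    [D'_0, D_0, D'_1, D_1, ...].  Then [b] has the norm of [A] at every point.
    The entry [b_ij] contributes to the martingale difference at the time at
    which the later of [D_i] and [D'_j] is revealed, and to no other.  Test the
    paraproduct on [f = D' x] for a constant vector [x].  If [j <= i], then
    [D'_j], hence [f_j], is known before [D_i] is revealed, and the entry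
    contributes [D_i A_ij D'_j D'_j x_j = D_i A_ij x_j].  If [i < j], then the
    entry appears together with [D'_j], just before which [f_j] has zero
    conditional expectation, and it contributes nothing.  Thus
    [pi_b f = D L x], where [L] is the lower triangular part of [A], and the
    norm of [pi_b] is at least [|L x| / |x|]: this is the lemma
    [paraproduct_sum_hilbert].

    What remains is the classical fact that triangular truncation is not bounded
    uniformly in the size.  The Hilbert matrix [1 / (2 (i - j) + 1)] has norm at
    most 2 for every size ([hilbert_bounded]): its entries change sign across the
    diagonal, and its columns are almost orthogonal, by partial fractions and
    telescoping.  The entries of its lower triangular part are all positive, so
    on the constant vector they add up to partial sums of the odd harmonic
    series, of logarithmic size ([hilbert_lower_unbounded]). *)

Set Implicit Arguments.
Unset Strict Implicit.
Unset Printing Implicit Defensive.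

Import Order.TTheory GRing.Theory Num.Theory.
Import numFieldNormedType.Exports.
Import ComplexField.Normc.

Local Open Scope classical_set_scope.
Local Open Scope ring_scope.
Local Open Scope complex_scope.

(** * The Hilbert matrix and its lower triangular part *)

Section HilbertKernel.
Variable R : realFieldType.
Implicit Types (z : int) (n : nat).

(** The kernel of the discrete Hilbert transform, shifted by a half integer so
    that the diagonal needs no separate convention: the denominator is odd. *)
Definition hilbert z : R := (2 * z%:~R + 1)^-1.

Lemma odd_int_neq0 z : 2 * z%:~R + 1 != 0 :> R.
Proof.
rewrite (_ : _ + _ = (2 * z + 1)%:~R) ?intr_eq0; first by lia.
by rewrite intrD intrM.
Qed.

Lemma hilbert_far n z : (0 < n)%N ->
  (n%:Z <= z) || (z + 1 <= - n%:Z) -> `|hilbert z| <= (2 * n%:R)^-1.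
Proof.
move=> n0 far; rewrite normfV lef_pV2 ?posrE ?mulr_gt0 ?ltr0n//; last first.
  by rewrite normr_gt0 odd_int_neq0.
have -> : 2 * z%:~R + 1 = (2 * z + 1)%:~R :> R by rewrite intrD intrM.
rewrite -intr_norm -natrM -[(2 * n)%:R]/((2 * n)%:Z%:~R) ler_int.
by lia.
Qed.

(** The identity behind the boundedness of the Hilbert matrix: the product of two
    entries of one row is a difference of entries divided by the distance of
    their columns, so that off-diagonal Gram entries telescope. *)
Lemma hilbert_partial_fraction z w : z != w ->
  hilbert z * hilbert w = (hilbert w - hilbert z) / (2 * (z - w)%:~R).
Proof.
move=> zw; have := odd_int_neq0 z; have := odd_int_neq0 w.
have : (z - w)%:~R != 0 :> R by rewrite intr_eq0 subr_eq0.
rewrite /hilbert intrB => h1 h2 h3; field.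
by rewrite h1 h2 h3.
Qed.

(** Telescoping with stride [d]: only the [d] first and the [d] last terms
    survive. *)
Lemma shift_sum (V : zmodType) (f : nat -> V) M d :
  \sum_(i < M) (f i - f (i + d)%N) =
  \sum_(i < d) f i - \sum_(i < d) f (M + i)%N.
Proof.
elim: M => [|M IH]; first by rewrite big_ord0 subrr.
rewrite big_ord_recr/= IH -!addrA; congr (_ + _).
have e : \sum_(i < d) f (M + i.+1)%N - \sum_(i < d) f (M + i)%N = f (M + d)%N - f M.
  rewrite -sumrB -(big_mkord xpredT (fun i => f (M + i.+1)%N - f (M + i)%N)).
  by rewrite telescope_sumr ?addn0.
rewrite -opprB -e opprB addKr; congr (- _).
by apply: eq_bigr => i _; rewrite addnS addSn.
Qed.

(** Each half of the two-sided series of the [1 / (2 m + 1) ^ 2] is at most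
    [3 / 2], by comparison with a telescoping series. *)
Lemma hilbert_sqr_sum c M : \sum_(i < c + M) hilbert (i%:Z - c%:Z) ^+ 2 <= 3.
Proof.
(* [B k] bounds the first [k] terms on one side; the bound 0 for no term at all
   makes the induction start on both sides at once. *)
pose B (k : nat) : R := if k is k'.+1 then 3 / 2 - (4 * k'.+1%:R)^-1 else 0.
have B32 k : B k <= 3 / 2.
  by case: k => [|k] /=; [lra|rewrite gerBl invr_ge0 mulr_ge0].
have Bstep k : B k + ((2 * k%:R + 1) ^+ 2)^-1 <= B k.+1.
  case: k => [|k]; first by rewrite /B mulr0 !add0r expr1n invr1 mulr1; lra.
  rewrite /B; set x := k.+1%:R : R.
  have x1 : 1 <= x by rewrite ler1n.
  have -> : k.+2%:R = x + 1 :> R by rewrite -natr1.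
  rewrite -subr_ge0.
  have -> : 3 / 2 - (4 * (x + 1))^-1 - (3 / 2 - (4 * x)^-1 + ((2 * x + 1) ^+ 2)^-1)
    = (4 * x * (x + 1) * (2 * x + 1) ^+ 2)^-1.
    by field; rewrite !gt_eqF//; lra.
  by rewrite invr_ge0 !mulr_ge0 ?exprn_ge0//; lra.
suff : \sum_(i < c + M) hilbert (i%:Z - c%:Z) ^+ 2 <= B c + B M.
  by move=> /le_trans; apply; have := B32 c; have := B32 M; lra.
elim: c => [|c IHc].
  rewrite add0n add0r; elim: M => [|M IHM]; first by rewrite big_ord0.
  rewrite big_ord_recr/= (le_trans _ (Bstep M))// lerD//.
  by rewrite /hilbert subr0 exprVn.
rewrite big_ord_recl/= addrC.
have -> : hilbert (0 - c.+1%:Z) ^+ 2 = ((2 * c%:R + 1) ^+ 2)^-1.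
  rewrite /hilbert exprVn (_ : (0 - c.+1%:Z)%:~R = - (c%:R + 1)).
    by congr (_^-1); ring.
  by rewrite sub0r intrN natr1.
have Bc := Bstep c.
have -> : B c.+1 + B M = (B c + B M) + (B c.+1 - B c) by ring.
apply: lerD; last by rewrite lerBrDl.
under eq_bigr => i _.
  rewrite (_ : _ - _ = i%:Z - c%:Z); last by rewrite /bump/=; lia.
  over.
exact: IHc.
Qed.

(** Gram matrix of the columns [0, ..., n - 1], with rows ranging over
    [-n, ..., 2 n - 1] instead of [0, ..., n - 1].  More rows only increase the
    norm, and the boundary terms left by the telescoping are then evaluated at
    distance at least [n] from the diagonal, where the kernel is small. *)
Definition hilbert_gram n (k l : nat) : R :=
  \sum_(i < 3 * n) hilbert (i%:Z - (n + k)%:Z) * hilbert (i%:Z - (n + l)%:Z).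

Lemma hilbert_gramC n k l : hilbert_gram n k l = hilbert_gram n l k.
Proof. by apply: eq_bigr => i _; rewrite mulrC. Qed.

Lemma hilbert_gram_diag n k : (k < n)%N -> `|hilbert_gram n k k| <= 3.
Proof.
move=> kn; rewrite ger0_norm; last first.
  by rewrite sumr_ge0// => i _; rewrite -expr2 sqr_ge0.
have window : (3 * n = n + k + (2 * n - k))%N by lia.
by rewrite /hilbert_gram window; exact: hilbert_sqr_sum.
Qed.

(** By partial fractions the sum over the rows telescopes to [2 d] boundary terms
    of size at most [1 / (2 n)], where [d = l - k]; the factor [1 / (2 d)]
    compensates their number. *)
Lemma hilbert_gram_ltn n k l : (k < l < n)%N ->
  `|hilbert_gram n k l| <= (2 * n%:R)^-1.
Proof.
move=> /andP[kl ln]; have n0 : (0 < n)%N by lia.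
pose d := (l - k)%N; have d0 : (0 < d)%N by rewrite /d; lia.
pose f (i : nat) := hilbert (i%:Z - (n + l)%:Z).
have fE : hilbert_gram n k l = (2 * d%:R)^-1 * \sum_(i < 3 * n) (f i - f (i + d)%N).
  rewrite mulr_sumr; apply: eq_bigr => i _.
  rewrite hilbert_partial_fraction; last by rewrite /d in d0; lia.
  rewrite mulrC /f; congr (_ * (_ - _)).
    by congr (_ * _)^-1; rewrite -[d%:R]/(d%:Z%:~R); congr (_%:~R); rewrite /d; lia.
  by congr hilbert; rewrite /d; lia.
rewrite fE shift_sum normrM ger0_norm ?invr_ge0 ?mulr_ge0//.
apply: (@le_trans _ _ ((2 * d%:R)^-1 * (2 * d%:R * (2 * n%:R)^-1))); last first.
  by rewrite mulKf// mulf_neq0// pnatr_eq0; lia.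
rewrite ler_wpM2l ?invr_ge0 ?mulr_ge0//.
rewrite (le_trans (ler_normB _ _))// -mulrA mulr_natl mulr2n.
have bnd g : (forall i, (i < d)%N -> `|f (g i)| <= (2 * n%:R)^-1) ->
    `|\sum_(i < d) f (g i)| <= d%:R * (2 * n%:R)^-1.
  move=> H; rewrite (le_trans (ler_norm_sum _ _ _))//.
  have -> : d%:R * (2 * n%:R)^-1 = \sum_(i < d) (2 * n%:R)^-1 :> R.
    by rewrite sumr_const card_ord mulr_natl.
  by apply: ler_sum => i _; exact: H.
by apply: lerD; [apply: (bnd id) => i|apply: (bnd (addn (3 * n))) => i];
  rewrite /d => id; apply: hilbert_far => //; lia.
Qed.

Lemma hilbert_gram_bound n k l : (k < n)%N -> (l < n)%N ->
  `|hilbert_gram n k l| <= 3 * (k == l)%:R + (2 * n%:R)^-1.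
Proof.
move=> kn ln; have n2 : 0 <= (2 * n%:R)^-1 :> R by rewrite invr_ge0 mulr_ge0.
have [kl|lk|<-] := ltngtP k l.
- by rewrite /= mulr0n mulr0 add0r hilbert_gram_ltn ?kl.
- by rewrite /= mulr0n mulr0 add0r hilbert_gramC hilbert_gram_ltn ?lk.
- by rewrite mulr1 (le_trans (hilbert_gram_diag _))//; lra.
Qed.

(** The Hilbert matrix has norm at most 2, whatever its size: its Gram matrix is
    dominated entrywise by 3 on the diagonal plus [1 / (2 n)] everywhere, and the
    second part has norm at most [1 / 2] since there are [n] columns. *)
Lemma hilbert_bounded n (x : 'I_n -> R) :
  \sum_(i < n) (\sum_(j < n) hilbert (i%:Z - j%:Z) * x j) ^+ 2 <=
  4 * \sum_(j < n) x j ^+ 2.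
Proof.
case: n x => [|n'] x; first by rewrite !big_ord0 mulr0.
set n := n'.+1.
pose y (i : nat) := \sum_(j < n) hilbert (i%:Z - (n + j)%:Z) * x j.
(* The rows of the square matrix are the middle third of those of the Gram matrix. *)
have le1 : \sum_(i < n) (\sum_(j < n) hilbert (i%:Z - j%:Z) * x j) ^+ 2 <=
    \sum_(i < 3 * n) y i ^+ 2.
  have -> : (3 * n = n + (n + n))%N by lia.
  rewrite !big_split_ord/= addrC -addrA.
  have -> : \sum_(i < n) (\sum_(j < n) hilbert (i%:Z - j%:Z) * x j) ^+ 2 =
      \sum_(i < n) y (n + i)%N ^+ 2.
    apply: eq_bigr => i _; congr (_ ^+ 2); apply: eq_bigr => j _.
    by congr (hilbert _ * _); lia.
  by rewrite lerDl addr_ge0// sumr_ge0// => i _; rewrite sqr_ge0.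
apply: (le_trans le1).
have -> : \sum_(i < 3 * n) y i ^+ 2 =
    \sum_(k < n) \sum_(l < n) hilbert_gram n k l * (x k * x l).
  under eq_bigr => i _.
    rewrite expr2 big_distrlr/=.
    under eq_bigr => k _ do under eq_bigr => l _ do rewrite mulrACA.
    over.
  rewrite exchange_big/=; apply: eq_bigr => k _.
  rewrite exchange_big/=; apply: eq_bigr => l _.
  by rewrite mulr_suml.
apply: (@le_trans _ _ (\sum_(k < n) \sum_(l < n)
    (3 * (k == l)%:R + (2 * n%:R)^-1) * ((x k ^+ 2 + x l ^+ 2) / 2))).
  apply: ler_sum => k _; apply: ler_sum => l _.
  rewrite (le_trans (ler_norm _))// normrM ler_pM//.
    exact: hilbert_gram_bound.
  have : 0 <= (`|x k| - `|x l|) ^+ 2 by rewrite sqr_ge0.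
  by rewrite normrM -(real_normK (num_real (x k))) -(real_normK (num_real (x l))); nra.
set S := \sum_(j < n) x j ^+ 2.
have S0 : 0 <= S by rewrite sumr_ge0// => i _; rewrite sqr_ge0.
have inner (k : 'I_n) : \sum_(l < n)
    (3 * (k == l)%:R + (2 * n%:R)^-1) * ((x k ^+ 2 + x l ^+ 2) / 2) =
    3 * x k ^+ 2 + (4 * n%:R)^-1 * (n%:R * x k ^+ 2 + S).
  under eq_bigr => l _ do rewrite mulrDl.
  rewrite big_split/=; congr (_ + _).
    rewrite (bigD1 k)//= big1 ?addr0; last first.
      by move=> l /negPf; rewrite eq_sym => ->; rewrite mulr0 mul0r.
    by rewrite eqxx mulr1n mulr1; lra.
  rewrite -mulr_sumr -mulr_suml big_split/= sumr_const card_ord -/S -mulr_natl.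
  by field; rewrite pnatr_eq0.
under eq_bigr do rewrite inner.
rewrite big_split/= -!mulr_sumr big_split/= -mulr_sumr sumr_const card_ord -/S.
rewrite -[S *+ n]mulr_natl.
have -> : (4 * n%:R)^-1 * (n%:R * S + n%:R * S) = S / 2.
  by field; rewrite pnatr_eq0.
lra.
Qed.

(** Row sums of the lower triangular part of the Hilbert matrix, diagonal
    included.  All the entries there are positive, so nothing cancels. *)
Definition hilbert_lower_sum (i : nat) : R :=
  \sum_(d < i.+1) (2 * d%:R + 1)^-1.

Lemma hilbert_lowerE n (i : 'I_n) :
  \sum_(j < n | (j <= i)%N) hilbert (i%:Z - j%:Z) = hilbert_lower_sum i.
Proof.
rewrite -(big_mkord (fun j => j <= i)%N (fun j => hilbert (i%:Z - j%:Z))).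
rewrite (@big_cat_nat _ _ _ i.+1)//= [X in _ + X]big_nat_cond.
rewrite [X in _ + X]big_pred0 ?addr0; last by move=> j; lia.
rewrite big_nat_rev/= add0n /hilbert_lower_sum -(big_mkord xpredT (fun d => (2 * d%:R + 1)^-1)).
rewrite big_nat_cond [RHS]big_nat_cond.
apply: eq_big => [j|j]; first by lia.
move=> /andP[/andP[_ ji] _].
rewrite /hilbert subSS (_ : _ - _ = j%:Z)//; lia.
Qed.

(** The term [1 / (2 d + 1)] occurs in [n - d] of the row sums. *)
Lemma sum_hilbert_lower_sum n :
  n%:R * (\sum_(d < n) (2 * d%:R + 1)^-1 - 1 / 2) <= \sum_(i < n) hilbert_lower_sum i.
Proof.
elim: n => [|n IHn]; first by rewrite mul0r big_ord0.
have lastE : hilbert_lower_sum n = \sum_(d < n.+1) (2 * d%:R + 1)^-1 by [].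
rewrite [leRHS]big_ord_recr/= lastE !big_ord_recr/= -natr1.
have n0 : 0 <= n%:R :> R by [].
have : n%:R * (2 * n%:R + 1)^-1 <= 1 / 2 :> R.
  by rewrite ler_pdivrMr; lra.
move: IHn; set S := \sum_(d < n) _; set T := \sum_(i < n) _; set v := (_ + 1)^-1.
by nra.
Qed.

End HilbertKernel.

Section LogarithmicGrowth.
Variable R : realType.
Implicit Types n : nat.

(** Termwise, [ln (1 + 1 / (n + 1)) <= 1 / (n + 1) <= 2 / (2 n + 1)]. *)
Lemma ln_le_odd_harmonic n : ln (n + 1)%:R <= 2 * \sum_(d < n) (2 * d%:R + 1)^-1 :> R.
Proof.
elim: n => [|n IHn]; first by rewrite big_ord0 add0n ln1 mulr0.
rewrite big_ord_recr/= mulrDr.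
have n1 : 0 < (n + 1)%:R :> R by rewrite ltr0n addn1.
have -> : (n.+1 + 1)%:R = (n + 1)%:R * (1 + (n + 1)%:R^-1) :> R.
  by rewrite mulrDr mulr1 divff ?gt_eqF// natr1 !addn1.
have i0 : 0 <= (n + 1)%:R^-1 :> R by rewrite invr_ge0 ltW.
rewrite lnM ?posrE//.
apply: lerD => //.
apply: (le_trans (le_ln1Dx _)); first by rewrite (lt_le_trans _ i0)// ltrN10.
rewrite -[leRHS]invrK lef_pV2 ?posrE//.
by rewrite invfM invrK natrD; have := ler0n R n; lra.
Qed.

(** The lower triangular part of the Hilbert matrix maps the constant vector 1,
    of squared norm [n], to a vector of mean at least [ln (n + 1) / 4]; the
    quadratic mean is at least the mean. *)
Lemma hilbert_lower_unbounded n :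
  n%:R * (ln (n + 1)%:R / 4) ^+ 2 <= \sum_(i < n) hilbert_lower_sum R i ^+ 2.
Proof.
set T := \sum_(i < n) hilbert_lower_sum R i ^+ 2.
have T0 : 0 <= T by rewrite sumr_ge0// => i _; rewrite sqr_ge0.
case: n @T T0 => [|n] T T0; first by rewrite mul0r.
set m := ln _ / 4.
have m0 : 0 <= m by rewrite divr_ge0// ln_ge0// ler1n addn1.
(* The loss of [1 / 2] is absorbed by the first term of the sum, which is 1. *)
have mO : m <= \sum_(d < n.+1) (2 * d%:R + 1)^-1 - 1 / 2.
  have O1 : 1 <= \sum_(d < n.+1) (2 * d%:R + 1)^-1 :> R.
    by rewrite big_ord_recl/= mulr0 add0r invr1 lerDl sumr_ge0.
  by have := ln_le_odd_harmonic n.+1; rewrite /m; lra.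
have : 0 <= \sum_(i < n.+1) (hilbert_lower_sum R i - m) ^+ 2.
  by rewrite sumr_ge0// => i _; rewrite sqr_ge0.
under eq_bigr do rewrite sqrrB.
rewrite big_split/= sumrB -/T sumr_const card_ord sumrMnl -mulr_suml.
move: mO (sum_hilbert_lower_sum R n.+1).
set U := \sum_(i < n.+1) hilbert_lower_sum R i; set O := \sum_(d < n.+1) _ => mO UO.
rewrite -[(m ^+ 2) *+ _]mulr_natl.
have N0 : 0 <= n.+1%:R :> R by [].
have : n.+1%:R * m <= U by rewrite (le_trans _ UO)// ler_wpM2l.
move: (n.+1%:R) N0 => N N0 h1; nra.
Qed.
End LogarithmicGrowth.

(** * The angle of a point of the circle *)

Section CircleAngle.
Variable R : realType.
Implicit Types (z w : circle R) (t : R).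

Lemma cos_eq1 t : 0 <= t < 2 * pi -> cos t = 1 -> t = 0.
Proof.
move=> /andP[t0 t2pi].
rewrite (_ : t = (t / 2) *+ 2); last by rewrite -mulr_natr; field.
rewrite cos_mulr2n => c1.
have : sin (t / 2) ^+ 2 = 0 by rewrite sin2cos2; lra.
move=> /eqP; rewrite sqrf_eq0 => /eqP s0.
have [t_gt0|t_le0] := ltP 0 t.
  have : 0 < sin (t / 2) by apply: sin_gt0_pi; lra.
  by rewrite s0 ltxx.
by rewrite (_ : t = 0) ?mul0r ?mul0rn//; apply/le_anti/andP.
Qed.

Lemma circle_eqP z w :
  complex.Re (circle_val z) = complex.Re (circle_val w) ->
  complex.Im (circle_val z) = complex.Im (circle_val w) -> z = w.
Proof.
move=> hR hI; apply: val_inj => /=.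
by case: (circle_val z) (circle_val w) hR hI => a b [c d] /= -> ->.
Qed.

Lemma circle_exp_inj s t : 0 <= s < 1 -> 0 <= t < 1 ->
  circle_exp s = circle_exp t -> s = t.
Proof.
wlog st : s t / t <= s.
  move=> H s01 t01 e; have [ts|st] := leP t s; first exact: H.
  by apply/esym/H => //; exact: ltW.
move=> s01 t01 e.
have [ec es] : cos (2 * pi * s) = cos (2 * pi * t) /\ sin (2 * pi * s) = sin (2 * pi * t).
  by move/(congr1 (@circle_val R)) : e => -[].
have pi0 : 0 < pi :> R := pi_gt0 R.
have /cos_eq1 : 0 <= 2 * pi * s - 2 * pi * t < 2 * pi.
  by apply/andP; split; nra.
rewrite cosB ec es -!expr2 cos2Dsin2 => /(_ erefl).
by rewrite -mulrBr => /eqP; rewrite !mulf_eq0 subr_eq0 pnatr_eq0/= gt_eqF//= => /eqP.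
Qed.

(** The inverse of [circle_exp] on [0, 1); it turns the dyadic arcs into dyadic
    intervals and the Haar measure into the Lebesgue measure. *)
Definition angle z : R :=
  let a := acos (complex.Re (circle_val z)) / (2 * pi) in
  if 0 <= complex.Im (circle_val z) then a else 1 - a.

Lemma circle_sqr z :
  complex.Re (circle_val z) ^+ 2 + complex.Im (circle_val z) ^+ 2 = 1.
Proof.
case: z => -[x y] /= /eqP; rewrite /normc => h.
by rewrite -(@sqr_sqrtr _ (x ^+ 2 + y ^+ 2)) ?h ?expr1n// addr_ge0 ?sqr_ge0.
Qed.

Lemma Re_circle_itv z : -1 <= complex.Re (circle_val z) <= 1.
Proof. by have := circle_sqr z; nra. Qed.

Lemma angle_itv z : 0 <= angle z < 1.
Proof.
have pi0 : 0 < pi :> R := pi_gt0 R.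
have [a0 api] := (acos_ge0 (Re_circle_itv z), acos_lepi (Re_circle_itv z)).
rewrite /angle /=; case: (leP 0 (complex.Im (circle_val z))) => h.
  by rewrite divr_ge0 ?mulr_ge0 ?(ltW pi0)//= ltr_pdivrMr ?mulr_gt0//; lra.
have : 0 < acos (complex.Re (circle_val z)).
  by apply: acos_gt0; have := circle_sqr z; nra.
move=> a_gt0; rewrite subr_ge0 ler_pdivrMr ?mulr_gt0// mul1r.
by rewrite gtrBl divr_gt0 ?mulr_gt0// andbT; lra.
Qed.

Lemma circle_exp_angle z : circle_exp (angle z) = z.
Proof.
have pi0 : (pi : R) != 0 by rewrite gt_eqF ?pi_gt0.
have z1 := Re_circle_itv z.
have sinE : sin (acos (complex.Re (circle_val z))) = `|complex.Im (circle_val z)|.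
  by rewrite sin_acos// -sqrtr_sqr; congr Num.sqrt; have := circle_sqr z; lra.
apply: circle_eqP => /=; rewrite /angle /=; case: (leP 0 (complex.Im (circle_val z))) => h.
- by rewrite mulrC divfK ?mulf_neq0// acosK.
- rewrite mulrBr mulr1 (mulrC (2 * pi) (_ / _)) divfK ?mulf_neq0//.
  by rewrite addrC mulr_natl cosD2pi cosN acosK.
- by rewrite mulrC divfK ?mulf_neq0// sinE ger0_norm.
- rewrite mulrBr mulr1 (mulrC (2 * pi) (_ / _)) divfK ?mulf_neq0//.
  by rewrite addrC mulr_natl sinD2pi sinN sinE ltr0_norm// opprK.
Qed.

Lemma angle_circle_exp t : 0 <= t < 1 -> angle (circle_exp t) = t.
Proof.
move=> t01; apply: circle_exp_inj => //; first exact: angle_itv.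
exact: circle_exp_angle.
Qed.

Lemma measurable_circle_coord : measurable_fun setT (@circle_coord R).
Proof.
by move=> _ B mB; rewrite setTI; exists B => //; rewrite setTI.
Qed.

Lemma measurable_angle : measurable_fun setT angle.
Proof.
have mR : measurable_fun setT (fun z => complex.Re (circle_val z)).
  exact: (measurableT_comp measurable_fst measurable_circle_coord).
have mI : measurable_fun setT (fun z => complex.Im (circle_val z)).
  exact: (measurableT_comp measurable_snd measurable_circle_coord).
(* Clamping the argument makes [acos] monotone on the whole line, hence
   measurable, without changing it on the coordinates of the circle. *)
pose ac (x : R) := acos (Num.max (-1) (Num.min 1 x)).
have mac : measurable_fun setT ac.
  apply: nonincreasing_measurable => // x y xy.
  rewrite /ac; set u := Num.max _ _; set v := Num.max _ _.
  have u1 : -1 <= v <= 1 by rewrite /v le_max lexx/= ge_max ge_min lexx/= andbT; lra.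
  have v1 : -1 <= u <= 1 by rewrite /u le_max lexx/= ge_max ge_min lexx/= andbT; lra.
  have uv : v <= u by rewrite /u /v; case: (leP 1 x); case: (leP 1 y);
    rewrite /Num.max/=; repeat case: ifP; lra.
  have [//|ac_lt] := leP (acos u) (acos v).
  have : cos (acos u) < cos (acos v).
    by rewrite ltr_cos// in_itv/= ?acos_ge0 ?acos_lepi.
  by rewrite !acosK// ltNge uv.
have -> : angle = fun z => if 0 <= complex.Im (circle_val z)
    then ac (complex.Re (circle_val z)) / (2 * pi)
    else 1 - ac (complex.Re (circle_val z)) / (2 * pi).
  apply/funext => z; have /andP[z0 z1] := Re_circle_itv z.
  by rewrite /angle /ac (min_r z1) (max_r z0).
have mac' : measurable_fun setT (fun z : circle R => ac (complex.Re (circle_val z)) / (2 * pi)).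
  by apply: measurable_funM => //; exact: (measurableT_comp mac mR).
apply: measurable_fun_ifT => //.
- exact: measurable_fun_ler.
- exact: measurable_funB.
Qed.

End CircleAngle.

(** * Dyadic conditional expectations and Rademacher functions *)

Section DyadicFiltration.
Variable R : realType.
Implicit Types (z w : circle R) (t : R) (k m j : nat).

(** The number of the arc of generation [k] that contains [z]. *)
Definition dyadic_index k z : nat := Num.truncn (2 ^+ k * angle z).

Lemma pow2_gt0 k : 0 < 2 ^+ k :> R. Proof. by rewrite exprn_gt0. Qed.

Lemma dyadic_index_eq k z j :
  (dyadic_index k z == j) = (j%:R / 2 ^+ k <= angle z < j.+1%:R / 2 ^+ k).
Proof.
have /andP[z0 _] := angle_itv z; have k0 := pow2_gt0 k.
rewrite truncn_eq ?mulr_ge0 ?(ltW k0)//.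
by rewrite ler_pdivrMr// ltr_pdivlMr// mulrC.
Qed.

Lemma dyadic_index_lt k z : (dyadic_index k z < 2 ^ k)%N.
Proof.
have /andP[z0 z1] := angle_itv z; have k0 := pow2_gt0 k.
by rewrite truncn_lt_nat ?mulr_ge0 ?(ltW k0)// natrX gtr_pMr.
Qed.

Lemma dyadic_index_half k z : dyadic_index k z = (dyadic_index k.+1 z)./2.
Proof.
have /andP[z0 _] := angle_itv z.
apply/eqP; rewrite truncn_eq; last by rewrite mulr_ge0// exprn_ge0.
have : 0 <= 2 ^+ k.+1 * angle z by rewrite mulr_ge0// exprn_ge0.
move/truncn_itv; rewrite -/(dyadic_index k.+1 z) exprS -mulrA.
set x := 2 ^+ k * angle z; set i := dyadic_index _ _ => /andP[ix xi].
apply/andP; split.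
  have : ((i./2 * 2)%:R <= i%:R :> R) by rewrite ler_nat; lia.
  by rewrite natrM; lra.
have : (i.+1%:R <= (i./2.+1 * 2)%:R :> R) by rewrite ler_nat; lia.
by rewrite natrM; lra.
Qed.

Lemma dyadic_index_coarser k m z w : (k <= m)%N ->
  dyadic_index m z = dyadic_index m w -> dyadic_index k z = dyadic_index k w.
Proof.
move=> /subnK <-; elim: (m - k)%N => [//|d IH] /= e.
by apply: IH; rewrite 2!(dyadic_index_half (d + k)) -addSn e.
Qed.

Lemma dyadic_arcE k j : (j < 2 ^ k)%N ->
  dyadic_arc k j = [set z | dyadic_index k z = j].
Proof.
move=> jk; apply/seteqP; split=> [_ [t /= + <-]|z /= /eqP].
  rewrite in_itv/= => /andP[jt tj]; apply/eqP; rewrite dyadic_index_eq.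
  rewrite angle_circle_exp ?jt//.
  rewrite (le_trans _ jt) ?divr_ge0 ?(ltW (pow2_gt0 k))//=.
  rewrite (lt_le_trans tj)// ler_pdivrMr ?pow2_gt0// mul1r.
  by rewrite -natrX ler_nat.
rewrite dyadic_index_eq => zj; exists (angle z); last exact: circle_exp_angle.
by rewrite /= in_itv.
Qed.

(** The dyadic sigma-algebra is atomic: a set belongs to it if and only if it is
    a union of arcs, that is, if membership can be read off the index. *)
Lemma dyadic_filtrationP k (A : set (circle R)) :
  dyadic_filtration k A <-> exists P : pred nat, A = [set z | P (dyadic_index k z)].
Proof.
split=> [FA|[P ->]].
  pose sat := [set B : set (circle R) |
    forall z w, dyadic_index k z = dyadic_index k w -> B z -> B w].
  have sA : sat A.
    apply: (smallest_sub _ _ FA); first split.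
    - by [].
    - move=> B sB z w e [_ nBz]; split=> // Bw; exact/nBz/(sB w z).
    - move=> F sF z w e [i _ Fi]; exists i => //; exact: (sF _ _ _ e).
    - by move=> _ [j /= jk <-]; rewrite dyadic_arcE// => z w /= ->.
  exists (fun j => `[< exists2 z, A z & dyadic_index k z = j >]).
  apply/seteqP; split=> [z Az|z /asboolP[w Aw wz]]/=; last exact: (sA w z).
  by apply/asboolP; exists z.
have -> : [set z | P (dyadic_index k z)] =
  \bigcup_j (if (j < 2 ^ k)%N && P j then dyadic_arc k j else set0).
  apply/seteqP; split=> [z /= Pz|z [j _]].
    by exists (dyadic_index k z) => //; rewrite dyadic_index_lt Pz/= dyadic_arcE ?dyadic_index_lt.
  by case: ifP => // /andP[jk Pj]; rewrite dyadic_arcE//= => ->.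
have [F0 _ FU] := smallest_sigma_algebra setT
  [set @dyadic_arc R k j | j in [set j | (j < 2 ^ k)%N]].
apply: FU => j; case: ifP => // /andP[jk _].
by apply: sub_sigma_algebra; exists j.
Qed.

(** Since the sigma-algebra is generated by a finite partition, measurability with
    respect to it is constancy on the arcs; this form makes sense for any target
    and is stable under all pointwise operations. *)
Definition dyadic_measurable k (T : Type) (f : circle R -> T) :=
  forall z w, dyadic_index k z = dyadic_index k w -> f z = f w.

Lemma dyadic_measurableW k m (T : Type) (f : circle R -> T) : (k <= m)%N ->
  dyadic_measurable k f -> dyadic_measurable m f.
Proof. by move=> km fk z w /(dyadic_index_coarser km); exact: fk. Qed.

Lemma measurable_dyadic_cell k j : measurable [set z | dyadic_index k z = j].
Proof.
have -> : [set z | dyadic_index k z = j] =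
    @angle R @^-1` `[j%:R / 2 ^+ k, j.+1%:R / 2 ^+ k[%classic.
  by apply/seteqP; split=> z /=; rewrite in_itv/= -dyadic_index_eq => /eqP.
by rewrite -[X in measurable X]setTI; exact: measurable_angle.
Qed.

Lemma dyadic_filtration_measurable k (A : set (circle R)) :
  dyadic_filtration k A -> measurable A.
Proof.
move=> /dyadic_filtrationP[P ->].
have -> : [set z | P (dyadic_index k z)] =
  \bigcup_j (if P j then [set z : circle R | dyadic_index k z = j] else set0).
  apply/seteqP; split=> [z /= Pz|z [j _]]; last by case: ifP => // Pj /= ->.
  by exists (dyadic_index k z) => //; rewrite Pz.
apply: bigcup_measurable => j _; case: ifP => // _.
exact: measurable_dyadic_cell.
Qed.

Lemma dyadic_filtration_preimage k (T : Type) (f : circle R -> T) (B : set T) :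
  dyadic_measurable k f -> dyadic_filtration k (f @^-1` B).
Proof.
move=> fk; apply/dyadic_filtrationP.
exists (fun j => `[< exists2 z, B (f z) & dyadic_index k z = j >]).
apply/seteqP; split=> [z Bz|z /asboolP[w Bw wz]]/=; first by apply/asboolP; exists z.
by rewrite -(fk w z).
Qed.

Lemma dyadic_measurable_fun k (f : circle R -> R) :
  dyadic_measurable k f -> measurable_fun setT f.
Proof.
move=> fk _ B _; rewrite setTI.
by apply: (@dyadic_filtration_measurable k); exact: dyadic_filtration_preimage.
Qed.

Lemma haar_dyadic_cell k j : (j < 2 ^ k)%N ->
  haar R [set z | dyadic_index k z = j] = (2 ^- k)%:E.
Proof.
move=> jk.
have k0 := pow2_gt0 k.
have jk1 : j.+1%:R / 2 ^+ k <= 1 :> R.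
  by rewrite ler_pdivrMr// mul1r -natrX ler_nat.
have j0 : 0 <= j%:R / 2 ^+ k :> R by rewrite divr_ge0// ltW.
rewrite /haar /distribution /pushforward/= /uniform_prob integral_uniform_pdf.
(* The uniform law charges the closed interval, whose end point 1 is sent to
   the same point of the circle as 0: a null set to be set aside. *)
have -> : @circle_exp R @^-1` [set z | dyadic_index k z = j] `&` `[0, 1]%classic =
   `[j%:R / 2 ^+ k, j.+1%:R / 2 ^+ k[%classic `|`
   (@circle_exp R @^-1` [set z | dyadic_index k z = j] `&` [set 1]).
  apply/seteqP; split=> t/=; rewrite !in_itv/=.
    move=> [/eqP tj /andP[t0]]; rewrite le_eqVlt => /orP[/eqP t1|t1].
      by right; split=> //; exact/eqP.
    by left; rewrite dyadic_index_eq angle_circle_exp ?t0 in tj.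
  move=> [/andP[jt tj]|[-> ->]]; last by rewrite ler01 lexx.
  have t01 : 0 <= t < 1 by rewrite (le_trans j0 jt) (lt_le_trans tj jk1).
  split; last by case/andP: t01 => -> /ltW ->.
  by apply/eqP; rewrite dyadic_index_eq angle_circle_exp// jt.
have m1 : measurable (@circle_exp R @^-1` [set z | dyadic_index k z = j] `&` [set 1]).
  apply: measurableI => //; rewrite -[X in measurable X]setTI.
  exact: (measurable_circle_exp measurableT (measurable_dyadic_cell k j)).
rewrite (eq_integral (fun=> 1%E)); last first.
  move=> t; rewrite inE /uniform_pdf subr0 invr1 => -[|[_ ->]].
    rewrite /= in_itv/= => /andP[jt tj].
    by rewrite (le_trans j0 jt) (ltW (lt_le_trans tj jk1)).
  by rewrite ler01 lexx.
rewrite integral_cst ?mul1e; last exact: measurableU.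
rewrite measureU0//=; last first.
  apply/eqP; rewrite eq_le measure_ge0 andbT -(@lebesgue_measure_set1 R 1).
  by apply: le_measure; rewrite ?inE//; exact: subIsetr.
rewrite lebesgue_measure_itv/= lte_fin ltr_pM2r ?invr_gt0// ltr_nat ltnSn.
by rewrite -EFinB -mulrBl -natrB// subSnn mul1r.
Qed.

(** A representative of each arc, at which dyadic functions are evaluated. *)
Definition dyadic_point k j : circle R := circle_exp (j%:R / 2 ^+ k).

Lemma dyadic_index_point k j : (j < 2 ^ k)%N ->
  dyadic_index k (dyadic_point k j) = j.
Proof.
move=> jk; have k0 := pow2_gt0 k.
apply/eqP; rewrite dyadic_index_eq angle_circle_exp; last first.
  by rewrite divr_ge0 ?(ltW k0)//= ltr_pdivrMr// mul1r -natrX ltr_nat.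
by rewrite lexx/= ltr_pM2r ?invr_gt0// ltr_nat.
Qed.

Lemma dyadic_measurable_sum k (f : circle R -> R) z : dyadic_measurable k f ->
  f z = \sum_(j < 2 ^ k) f (dyadic_point k j) *
    \1_[set w | dyadic_index k w = j] z.
Proof.
move=> fk; rewrite (bigD1 (Ordinal (dyadic_index_lt k z)))//= big1.
  rewrite indicE mem_set// mulr1 addr0; apply: fk.
  by rewrite dyadic_index_point// dyadic_index_lt.
move=> j jz; rewrite indicE memNset ?mulr0//= => zj.
by move/negP : jz; apply; rewrite -val_eqE/= zj.
Qed.

Lemma integrable_dyadic k (f : circle R -> R) A : dyadic_measurable k f ->
  measurable A -> (haar R).-integrable A (EFin \o f).
Proof.
move=> fk mA; apply: (@integrableS _ _ _ (haar R) setT) => //.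
have -> : EFin \o f = (fun z => \sum_(j < 2 ^ k) ((f (dyadic_point k j))%:E *
    (\1_[set w | dyadic_index k w = j] z)%:E))%E.
  by apply/funext => z /=; rewrite [f z in LHS](dyadic_measurable_sum _ fk) -sumEFin.
apply: integrable_sum => //= j _; apply: integrableZl => //.
by apply: integrable_indic; exact: measurable_dyadic_cell.
Qed.

Lemma integral_dyadic k (f : circle R -> R) : dyadic_measurable k f ->
  (\int[haar R]_z (f z)%:E =
    (2 ^- k * \sum_(j < 2 ^ k) f (dyadic_point k j))%:E)%E.
Proof.
move=> fk.
pose F (j : 'I_(2 ^ k)) z := ((f (dyadic_point k j))%:E *
    (\1_[set w | dyadic_index k w = j] z)%:E)%E.
have iF (j : 'I_(2 ^ k)) : (haar R).-integrable setT (F j).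
  apply: integrableZl => //.
  by apply: integrable_indic; exact: measurable_dyadic_cell.
rewrite (eq_integral (fun z => \sum_(j < 2 ^ k) F j z)%E); last first.
  by move=> z _; rewrite (dyadic_measurable_sum _ fk) -sumEFin.
rewrite integral_sum// mulr_sumr -sumEFin; apply: eq_bigr => j _.
rewrite integralZl//; last by apply: integrable_indic; exact: measurable_dyadic_cell.
rewrite integral_indic//; last exact: measurable_dyadic_cell.
rewrite setIT [X in (_ * X)%E](_ : _ = (2 ^- k)%:E); last exact: haar_dyadic_cell.
by rewrite -EFinM mulrC.
Qed.

(** Conditional expectations on the dyadic filtration are unique pointwise, and
    not only almost everywhere: versions are constant on the arcs, and arcs have
    positive measure. *)
Lemma condexp_unique k (f g : circle R -> R) :
  is_condexp (dyadic_filtration k) f g -> condexp (dyadic_filtration k) f = g.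
Proof.
move=> fg; rewrite /condexp; case: xgetP => [g' _ fg'|/(_ g)]; last by [].
have cst h w z : is_condexp (dyadic_filtration k) f h ->
    dyadic_index k z = dyadic_index k w -> h w = h z.
  move=> [hm _ _] e.
  have /dyadic_filtrationP[P hP] := hm [set h z] (measurable_set1 _).
  have : (h @^-1` [set h z]) z by [].
  by rewrite hP/= e => Pw; have : (h @^-1` [set h z]) w by rewrite hP.
apply/funext => z; pose A := [set w | dyadic_index k w = dyadic_index k z].
have FA : dyadic_filtration k A.
  by apply/dyadic_filtrationP; exists (fun j => j == dyadic_index k z);
    apply/seteqP; split=> w /= => [->|/eqP].
have mA := dyadic_filtration_measurable FA.
have intA h : is_condexp (dyadic_filtration k) f h ->
    \int[haar R]_(w in A) f w = h z * 2 ^- k.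
  move=> fh; have [_ _ <-//] := fh.
  rewrite (@eq_Rintegral _ _ _ (haar R) A (fun=> h z)); last first.
    by move=> w; rewrite inE /A/= => e; exact: (cst h w z).
  have hA : haar R A = (2 ^- k)%:E by rewrite haar_dyadic_cell// dyadic_index_lt.
  transitivity (h z * fine (haar R A)); last by rewrite hA.
  by apply: Rintegral_cst => //; rewrite [X in (X < _)%E]hA ltry.
have := intA g' fg'; rewrite (intA g fg) => /mulIf -> //.
Qed.

Lemma condexp_dyadic_measurable k (f : circle R -> R) :
  dyadic_measurable k f -> condexp (dyadic_filtration k) f = f.
Proof.
move=> fk; apply: condexp_unique; split=> //.
- by move=> B _; exact: dyadic_filtration_preimage.
- exact: (integrable_dyadic fk).
Qed.

(** The sign of the [k]-th binary digit of the angle. *)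
Definition rademacher k z : R := (-1) ^+ dyadic_index k z.

Lemma rademacher_measurable k : dyadic_measurable k (rademacher k).
Proof. by move=> z w e; rewrite /rademacher e. Qed.

Lemma rademacher_sqr k z : rademacher k z ^+ 2 = 1.
Proof. by rewrite sqrr_sign. Qed.

(** Each arc of generation [k] is the union of two arcs of generation [k + 1] of
    equal measure, on which the next sign takes opposite values. *)
Lemma integral_rademacher k (f : circle R -> R) : dyadic_measurable k f ->
  (\int[haar R]_z (f z * rademacher k.+1 z)%:E = 0)%E.
Proof.
move=> fk.
have fr : dyadic_measurable k.+1 (fun z => f z * rademacher k.+1 z).
  move=> z w e; rewrite (rademacher_measurable e).
  by rewrite (dyadic_measurableW (leqnSn k) fk e).
rewrite (integral_dyadic fr).
pose F j := f (dyadic_point k.+1 j) * rademacher k.+1 (dyadic_point k.+1 j).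
rewrite -(big_mkord xpredT F) expnS mulnC.
suff : forall N, (N <= 2 ^ k)%N -> \sum_(0 <= j < N * 2) F j = 0.
  by move=> -> //; rewrite mulr0.
elim=> [|N IH] Nk; first by rewrite big_geq.
rewrite mulSn add2n big_nat_recr// big_nat_recr// (IH (ltnW Nk)) /= add0r.
have N1 : ((N * 2).+1 < 2 ^ k.+1)%N by rewrite expnS; lia.
rewrite /F /rademacher !dyadic_index_point//; last exact: ltnW.
have -> : f (dyadic_point k.+1 (N * 2).+1) = f (dyadic_point k.+1 (N * 2)).
  apply: fk; rewrite 2!(dyadic_index_half k) !dyadic_index_point//; last exact: ltnW.
  by lia.
by rewrite exprS mulN1r mulrN addrN.
Qed.

(** A sign not yet revealed at time [k] has mean zero on every set of the
    filtration, even after multiplication by earlier quantities. *)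
Lemma condexp_rademacher k m (f : circle R -> R) : (k <= m)%N ->
  dyadic_measurable m f ->
  condexp (dyadic_filtration k) (fun z => f z * rademacher m.+1 z) = cst 0.
Proof.
move=> km fm; apply: condexp_unique; split=> //.
- move=> B _; exact: dyadic_filtration_preimage.
- exact: (@integrable_dyadic 0).
move=> A FA; rewrite Rintegral_cst//; last exact: (dyadic_filtration_measurable FA).
rewrite mul0r /Rintegral integral_mkcond/=.
have [P AP] := (dyadic_filtrationP k A).1 FA.
(* The indicator of [A] is an earlier quantity too, so it joins [f]. *)
rewrite (eq_integral (fun z => (\1_A z * f z * rademacher m.+1 z)%:E)); last first.
  move=> z _; rewrite patchE indicE; case: ifPn => zA; first by rewrite mul1r.
  by rewrite !mul0r.
rewrite integral_rademacher// => z w e.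
rewrite (fm _ _ e) !indicE AP; congr (_ * _); congr (nat_of_bool _)%:R.
by apply/idP/idP; rewrite !inE/= (dyadic_index_coarser km e).
Qed.
End DyadicFiltration.

(** * Vector norms and paraproducts with finitely many terms *)

Section VectorNorms.
Variable R : realType.
Implicit Types (z : circle R).

Lemma sqr_normc_ReIm (x : R[i]) :
  normc x ^+ 2 = complex.Re x ^+ 2 + complex.Im x ^+ 2.
Proof. by case: x => a b; rewrite /normc sqr_sqrtr// addr_ge0 ?sqr_ge0. Qed.

Lemma vnormE n (v : 'cV[R[i]]_n) : vnorm v =
  Num.sqrt (\sum_(i < n) (complex.Re (v i 0) ^+ 2 + complex.Im (v i 0) ^+ 2)).
Proof. by congr Num.sqrt; apply: eq_bigr => i _; rewrite sqr_normc_ReIm. Qed.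

Lemma vnorm_ge0 n (v : 'cV[R[i]]_n) : 0 <= vnorm v.
Proof. exact: sqrtr_ge0. Qed.

Lemma vnorm_real n (x : 'I_n -> R) :
  vnorm (\col_i (x i)%:C) = Num.sqrt (\sum_(i < n) x i ^+ 2).
Proof.
rewrite vnormE; congr Num.sqrt; apply: eq_bigr => i _.
by rewrite !mxE/= expr0n addr0.
Qed.

Lemma vnorm0 n : vnorm (0 : 'cV[R[i]]_n) = 0.
Proof. by rewrite vnormE big1 ?sqrtr0// => i _; rewrite mxE/= expr0n addr0. Qed.

Lemma vnorm_eq0 n (v : 'cV[R[i]]_n) : vnorm v = 0 -> v = 0.
Proof.
have sq0 (x : R[i]) : 0 <= complex.Re x ^+ 2 + complex.Im x ^+ 2.
  by rewrite addr_ge0 ?sqr_ge0.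
rewrite vnormE => /eqP; rewrite sqrtr_eq0 => le0.
have /eqP : \sum_(i < n) (complex.Re (v i 0) ^+ 2 + complex.Im (v i 0) ^+ 2) = 0.
  by apply/le_anti/andP; split=> //; apply: sumr_ge0.
rewrite psumr_eq0// => /allP v0; apply/matrixP => i j; rewrite ord1 mxE.
have := v0 i (mem_index_enum _).
rewrite /= paddr_eq0 ?sqr_ge0// !sqrf_eq0 => /andP[/eqP re /eqP im].
by case: (v i 0) re im => a b /= -> ->.
Qed.

(** A real matrix acts separately on the real and the imaginary parts of a
    vector, so its norm on complex vectors is its norm on real ones. *)
Lemma real_matrix_opnorm_le n (A : 'I_n -> 'I_n -> R) (C : R) : 0 <= C ->
  (forall x : 'I_n -> R,
    \sum_i (\sum_j A i j * x j) ^+ 2 <= C ^+ 2 * \sum_j x j ^+ 2) ->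
  mx_opnorm (\matrix_(i, j) (A i j)%:C) <= C.
Proof.
move=> C0 AC; apply: ge_sup.
  by exists (vnorm ((\matrix_(i, j) (A i j)%:C) *m 0)), 0 => //=; rewrite vnorm0.
move=> _ [v /= v1 <-].
rewrite vnormE -[leRHS]ger0_norm// -[leRHS]sqrtr_sqr ler_sqrt ?sqr_ge0//.
have -> : \sum_(i < n) (complex.Re (((\matrix_(i, j) (A i j)%:C) *m v) i 0) ^+ 2 +
      complex.Im (((\matrix_(i, j) (A i j)%:C) *m v) i 0) ^+ 2) =
   \sum_i (\sum_j A i j * complex.Re (v j 0)) ^+ 2 +
   \sum_i (\sum_j A i j * complex.Im (v j 0)) ^+ 2.
  rewrite -big_split/=; apply: eq_bigr => i _; rewrite mxE.
  congr (_ ^+ 2 + _ ^+ 2).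
    rewrite (raddf_sum (@complex.Re R)); apply: eq_bigr => j _.
    by rewrite mxE; case: (v j 0) => a b /=; rewrite mul0r subr0.
  rewrite (raddf_sum (@complex.Im R)); apply: eq_bigr => j _.
  by rewrite mxE; case: (v j 0) => a b /=; rewrite mul0r addr0.
rewrite (le_trans (lerD (AC _) (AC _)))// -mulrDr -big_split/=.
rewrite ler_piMr ?sqr_ge0//.
by move: v1; rewrite vnormE -[X in _ <= X -> _]sqrtr1 ler_sqrt.
Qed.

Lemma measurable_vnorm n (f : circle R -> 'cV[R[i]]_n) : mx_measurable f ->
  measurable_fun setT (fun z => vnorm (f z)).
Proof.
move=> mf; under eq_fun do rewrite vnormE.
apply: (measurableT_comp (continuous_measurable_fun (@sqrt_continuous R))) => /=.
apply: measurable_sum => i; have [mR mI] := mf i 0.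
by apply: measurable_funD; apply: measurable_funX.
Qed.

Lemma mx_measurableB m n (f g : circle R -> 'M[R[i]]_(m, n)) :
  mx_measurable f -> mx_measurable g -> mx_measurable (fun z => f z - g z).
Proof.
move=> mf mg i j; have [fR fI] := mf i j; have [gR gI] := mg i j.
by split; [under eq_fun do rewrite !mxE raddfB/=|under eq_fun do rewrite !mxE raddfB/=];
  exact: measurable_funB.
Qed.

Lemma dyadic_mx_measurable m n k (f : circle R -> 'M[R[i]]_(m, n)) :
  dyadic_measurable k f -> mx_measurable f.
Proof.
by move=> fk i j; split; apply: (@dyadic_measurable_fun _ k) => z w /fk ->.
Qed.

Lemma L2_norm_cst n (f : circle R -> 'cV[R[i]]_n) (c : R) :
  (forall z, vnorm (f z) = c) -> L2_norm f = c%:E.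
Proof.
move=> fc; have c0 : 0 <= c by rewrite -(fc point) vnorm_ge0.
rewrite /L2_norm unlock /Lnorm (eq_integral (fun=> (c ^+ 2)%:E)); last first.
  by move=> z _; rewrite fc/= ger0_norm// powR_mulrn.
rewrite integral_cst// [X in (_ * X)%E](_ : _ = 1%E); last exact: probability_setT.
by rewrite mule1/= -powR_mulrn// -powRrM divff ?powRr1.
Qed.

Lemma L2_norm_eq0 n (f : circle R -> 'cV[R[i]]_n) : mx_measurable f ->
  L2_norm f = 0%E -> \forall z \ae haar R, f z = 0.
Proof.
move=> mf /Lnorm_eq0_eq0 f0.
have /f0 : measurable_fun setT (fun z => (vnorm (f z))%:E).
  by apply/measurable_EFinP; exact: measurable_vnorm.
rewrite lte_fin ltr0n => /(_ isT); apply: filterS => z /(_ I) /= [] .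
exact: vnorm_eq0.
Qed.

Lemma eq_L2_norm_ae n (f g : circle R -> 'cV[R[i]]_n) :
  mx_measurable f -> mx_measurable g ->
  (\forall z \ae haar R, f z = g z) -> L2_norm f = L2_norm g.
Proof.
move=> mf mg fg.
have m2 (h : circle R -> 'cV[R[i]]_n) : mx_measurable h ->
    measurable_fun setT (fun z => (`|(vnorm (h z))%:E| `^ 2)%E).
  move=> mh; apply: (@measurableT_comp _ _ _ _ _ _ (fun x => (x `^ 2)%E)) => //.
    exact: measurable_poweR.
  by apply: measurableT_comp => //; apply/measurable_EFinP; exact: measurable_vnorm.
have fgE : (\int[haar R]_z (`|(vnorm (f z))%:E| `^ 2) =
    \int[haar R]_z (`|(vnorm (g z))%:E| `^ 2))%E.
  apply: ae_eq_integral; [exact: measurableT|exact: m2|exact: m2|].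
  by apply: filterS fg => z -> _.
by rewrite /L2_norm unlock /Lnorm fgE.
Qed.

(** When the partial sums are eventually equal to [h], the paraproduct is the
    value of a finite sum: its defining limit can only be a function equal to
    [h] almost everywhere. *)
Lemma L2_norm_paraproduct n (b : circle R -> 'M[R[i]]_n)
    (f h : circle R -> 'cV[R[i]]_n) N0 : in_L2 h ->
  (forall N z, (N0 <= N)%N -> paraproduct_sum b f N z = h z) ->
  L2_norm (paraproduct b f) = L2_norm h.
Proof.
move=> hL2 sumE.
rewrite /paraproduct; case: xgetP => [g _ [gL2 cvg_g]|/(_ h)[]]; last first.
  split=> //; apply: cvg_near_cst; exists N0 => // N /= N0N.
  by apply: L2_norm_cst => z; rewrite sumE// subrr vnorm0.
have cvg_h : L2_norm (fun z => paraproduct_sum b f N z - g z) @[N --> \oo] -->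
    L2_norm (fun z => h z - g z).
  apply: cvg_near_cst; exists N0 => // N /= N0N.
  by congr L2_norm; apply/funext => z; rewrite sumE.
have hg0 : L2_norm (fun z => h z - g z) = 0%E.
  by rewrite -(cvg_lim (@ereal_hausdorff R) cvg_h) (cvg_lim (@ereal_hausdorff R) cvg_g).
apply: eq_L2_norm_ae; [exact: gL2.1|exact: hL2.1|].
apply: filterS (L2_norm_eq0 (mx_measurableB hL2.1 gL2.1) hg0) => z /eqP.
by rewrite subr_eq0 => /eqP.
Qed.

End VectorNorms.

(** * The paraproduct of the signed Hilbert matrix *)

Section HilbertParaproduct.
Variables (R : realType) (n : nat).
Implicit Types (z : circle R) (i j : 'I_n) (k : nat).

(** A product of signs is known as soon as its latest factor is; until then that
    factor is a fair sign independent of the others, and it kills the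
    expectation. *)
Lemma condexp_rademacher_factor k m (g : circle R -> R) :
  dyadic_measurable m g ->
  condexp (dyadic_filtration k) (fun z => g z * rademacher m.+1 z) =
  fun z => if (m < k)%N then g z * rademacher m.+1 z else 0.
Proof.
move=> gm; case: leqP => [km|mk]; first exact: condexp_rademacher.
apply: condexp_dyadic_measurable => z w e.
rewrite (dyadic_measurableW (ltnW mk) gm e).
by rewrite (dyadic_measurableW mk (@rademacher_measurable R m.+1) e).
Qed.

Lemma dyadic_E_real p q k (phi : 'I_p -> 'I_q -> circle R -> R) z :
  dyadic_E k (fun w => \matrix_(i, j) (phi i j w)%:C) z =
  \matrix_(i, j) (condexp (dyadic_filtration k) (phi i j) z)%:C.
Proof.
apply/matrixP => i j; rewrite !mxE.
have -> : (fun w => complex.Re ((\matrix_(i, j) (phi i j w)%:C) i j)) = phi i j.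
  by apply/funext => w; rewrite mxE.
have -> : (fun w => complex.Im ((\matrix_(i, j) (phi i j w)%:C) i j)) = cst 0.
  by apply/funext => w; rewrite mxE.
by rewrite (@condexp_dyadic_measurable R k (cst 0)).
Qed.

(** The signs are revealed in the order: column 0, row 0, column 1, row 1, and so
    on; so the sign of column [j] precedes that of row [i] exactly when
    [j <= i]. *)
Definition row_sign (i : nat) z := rademacher i.*2.+2 z.
Definition col_sign (j : nat) z := rademacher j.*2.+1 z.

(** The factor [1 / 2] turns the signed Hilbert matrix into a contraction. *)
Definition hilbert_symbol z : 'M[R[i]]_n :=
  \matrix_(i, j) (hilbert R (i%:Z - j%:Z) / 2 * row_sign i z * col_sign j z)%:C.

Definition test_vector z : 'cV[R[i]]_n :=
  \matrix_(j, _) ((Num.sqrt n%:R)^-1 * col_sign j z)%:C.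

(** The row signs times the image, under the lower triangular part of the matrix,
    of the normalized constant vector: the value of the paraproduct. *)
Definition test_image z : 'cV[R[i]]_n :=
  \col_i (row_sign i z * ((Num.sqrt n%:R)^-1 * (hilbert_lower_sum R i / 2)))%:C.

(** The time at which both signs of the entry [i, j] have been revealed. *)
Definition entry_time i j := maxn i.*2.+2 j.*2.+1.

(** The later of the two signs is the row sign on and below the diagonal, and the
    column sign above it; the other one is absorbed in the earlier factor. *)
Lemma dyadic_E_symbol k z : dyadic_E k hilbert_symbol z =
  \matrix_(i, j) if (entry_time i j <= k)%N then hilbert_symbol z i j else 0.
Proof.
rewrite dyadic_E_real; apply/matrixP => i j; rewrite !mxE.
set c := hilbert R _ / 2.
have Mr m k' : (k' <= m)%N -> dyadic_measurable m (fun z => c * @rademacher R k' z).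
  move=> km x y e; congr (_ * _).
  exact: (dyadic_measurableW km (@rademacher_measurable R k') e).
rewrite /entry_time; case: (leqP j i) => ij.
  have -> : (fun z => c * row_sign i z * col_sign j z) =
      fun z => (c * rademacher j.*2.+1 z) * rademacher i.*2.+2 z.
    by apply/funext => w; rewrite mulrAC.
  rewrite condexp_rademacher_factor; last by apply: Mr; lia.
  rewrite (_ : (maxn _ _ <= k)%N = (i.*2.+1 < k)%N); last by lia.
  by case: ifP => // _; rewrite mulrAC.
rewrite condexp_rademacher_factor; last by apply: Mr; lia.
rewrite (_ : (maxn _ _ <= k)%N = (j.*2 < k)%N); last by lia.
by case: ifP.
Qed.

Lemma dyadic_d_symbol k z : (0 < k)%N -> dyadic_d k hilbert_symbol z =
  \matrix_(i, j) if entry_time i j == k then hilbert_symbol z i j else 0.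
Proof.
move=> k0; rewrite /dyadic_d !dyadic_E_symbol; apply/matrixP => i j.
rewrite !mxE.
have [<-|ne] := eqVneq (entry_time i j) k.
  by rewrite leqnn ifF ?subr0// /entry_time; lia.
rewrite (_ : (entry_time i j <= k.-1)%N = (entry_time i j <= k)%N) ?subrr//.
by lia.
Qed.

Lemma dyadic_E_test k z : dyadic_E k test_vector z =
  \matrix_(j, l) if (j.*2 < k)%N then test_vector z j l else 0.
Proof.
rewrite dyadic_E_real; apply/matrixP => j l; rewrite !mxE.
by rewrite condexp_rademacher_factor//; case: ifP.
Qed.

(** In row [i], the [j]-th entry of the symbol is multiplied by what is known of
    the [j]-th coordinate of the test vector just before the entry appears.  If
    [j <= i] the entry appears with its row sign, and the coordinate is already
    known; if [i < j] it appears with its column sign, and the coordinate still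
    has zero expectation.  The column signs then square to 1, and only the lower
    triangular part is left. *)
Lemma paraproduct_sum_hilbert N z : (n.*2 <= N)%N ->
  paraproduct_sum hilbert_symbol test_vector N z = test_image z.
Proof.
move=> nN; apply/matrixP => i l; rewrite ord1 {l} /paraproduct_sum summxE.
have termE k : (1 <= k < N.+1)%N ->
    (dyadic_d k hilbert_symbol z *m dyadic_E k.-1 test_vector z) i 0 =
    \sum_(j < n | (j <= i)%N) (if k == i.*2.+2
      then hilbert_symbol z i j * test_vector z j 0 else 0).
  move=> /andP[k0 _]; rewrite mxE dyadic_d_symbol// dyadic_E_test.
  rewrite [RHS]big_mkcond/=; apply: eq_bigr => j _; rewrite !mxE /entry_time.
  case: (leqP j i) => ij.
    rewrite (_ : maxn _ _ = i.*2.+2); last by lia.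
    rewrite eq_sym; case: eqP => [->|_]; last by rewrite mul0r.
    by rewrite ifT//; lia.
  rewrite (_ : maxn _ _ = j.*2.+1); last by lia.
  by case: eqP => [<-|_]; rewrite ?mul0r// ifF ?mulr0//; lia.
rewrite big_nat_cond (eq_bigr _ (fun k h => termE k (proj1 (andP h)))) -big_nat_cond.
rewrite exchange_big/= [RHS]mxE.
transitivity (\sum_(j < n | (j <= i)%N) (row_sign i z * ((Num.sqrt n%:R)^-1 *
    (hilbert R (i%:Z - j%:Z) / 2)))%:C).
  apply: eq_bigr => j _; rewrite -big_mkcond/= big_nat1_eq.
  rewrite ifT; last by have := ltn_ord i; lia.
  rewrite !mxE -rmorphM/=; congr (_%:C).
  transitivity (hilbert R (i%:Z - j%:Z) / 2 * row_sign i z * (Num.sqrt n%:R)^-1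
     * col_sign j z ^+ 2); first by ring.
  by rewrite rademacher_sqr; ring.
rewrite -rmorph_sum/=; congr (_%:C).
by rewrite -!mulr_sumr -mulr_suml hilbert_lowerE.
Qed.

(** Multiplying rows and columns by signs does not change the norm. *)
Lemma hilbert_symbol_opnorm z : mx_opnorm (hilbert_symbol z) <= 1.
Proof.
apply: real_matrix_opnorm_le => // x.
rewrite expr1n mul1r.
have := hilbert_bounded (fun j : 'I_n => col_sign j z * x j).
rewrite (eq_bigr (fun i : 'I_n => 4 * (\sum_(j < n) hilbert R (i%:Z - j%:Z) / 2 *
    row_sign i z * col_sign j z * x j) ^+ 2)).
  rewrite -mulr_sumr ler_pM2l//; under [X in _ <= X -> _]eq_bigr do
    rewrite exprMn rademacher_sqr mul1r.
  by [].
move=> i _; rewrite (_ : \sum_(j < n) hilbert R (i%:Z - j%:Z) / 2 *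
    row_sign i z * col_sign j z * x j =
  row_sign i z / 2 * \sum_(j < n) hilbert R (i%:Z - j%:Z) * (col_sign j z * x j)).
  by rewrite exprMn exprMn rademacher_sqr; lra.
by rewrite mulr_sumr; apply: eq_bigr => j _; ring.
Qed.

Lemma vnorm_test_vector z : vnorm (test_vector z) = Num.sqrt (n%:R / n%:R).
Proof.
have -> : test_vector z = \col_j ((Num.sqrt n%:R)^-1 * col_sign j z)%:C.
  by apply/matrixP => j l; rewrite !mxE.
rewrite vnorm_real; congr Num.sqrt.
under eq_bigr do rewrite exprMn rademacher_sqr mulr1 exprVn sqr_sqrtr//.
by rewrite sumr_const card_ord -[_ *+ n]mulr_natl.
Qed.

Lemma vnorm_test_image z : vnorm (test_image z) =
  Num.sqrt (n%:R^-1 * \sum_(i < n) hilbert_lower_sum R i ^+ 2) / 2.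
Proof.
rewrite vnorm_real.
have -> : \sum_(i < n) (row_sign i z * ((Num.sqrt n%:R)^-1 *
    (hilbert_lower_sum R i / 2))) ^+ 2 =
    n%:R^-1 * (\sum_(i < n) hilbert_lower_sum R i ^+ 2) * (2^-1) ^+ 2.
  rewrite mulr_sumr mulr_suml; apply: eq_bigr => i _.
  rewrite exprMn rademacher_sqr mul1r !exprMn !exprVn sqr_sqrtr//.
  by rewrite mulrA.
by rewrite sqrtrM ?sqrtr_sqr ?ger0_norm// mulr_ge0 ?invr_ge0// sumr_ge0// => i _; rewrite sqr_ge0.
Qed.

Lemma row_sign_measurable i : dyadic_measurable n.*2 (row_sign i).
Proof.
move=> z w; apply: (dyadic_measurableW _ (@rademacher_measurable R _)).
by have := ltn_ord i; lia.
Qed.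

Lemma col_sign_measurable j : dyadic_measurable n.*2 (col_sign j).
Proof.
move=> z w; apply: (dyadic_measurableW _ (@rademacher_measurable R _)).
by have := ltn_ord j; lia.
Qed.
End HilbertParaproduct.

Theorem theorem1p1 (R : realType) :
  exists2 c : R, (0 < c)%R &
    forall n : nat,
      exists b : circle R -> 'M[R[i]]_n,
        [/\ mx_measurable b,
            (Linfty_norm b <= 1)%E &
            ((c * ln (n + 1)%:R)%:E <= L2_opnorm (paraproduct b))%E].
Proof.
exists 8^-1; first by rewrite invr_gt0.
move=> n; exists (@hilbert_symbol R n).
have mimage : mx_measurable (@test_image R n).
  apply: (@dyadic_mx_measurable _ _ _ n.*2) => z w e.
  by apply/matrixP => i l; rewrite !mxE (row_sign_measurable i e).
have mtest : mx_measurable (@test_vector R n).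
  apply: (@dyadic_mx_measurable _ _ _ n.*2) => z w e.
  by apply/matrixP => i l; rewrite !mxE (col_sign_measurable i e).
split.
- apply: (@dyadic_mx_measurable _ _ _ n.*2) => z w e.
  by apply/matrixP => i l; rewrite !mxE (col_sign_measurable l e) (row_sign_measurable i e).
- apply/ess_supP; apply: nearW => z.
  by rewrite lee_fin hilbert_symbol_opnorm.
- apply: (@le_trans _ _ (L2_norm (paraproduct (@hilbert_symbol R n) (@test_vector R n)))); last first.
    apply: ereal_sup_ubound; exists (@test_vector R n) => //.
    have normT : (L2_norm (@test_vector R n) <= 1)%E.
      rewrite (L2_norm_cst (@vnorm_test_vector R n)) lee_fin -[leRHS]sqrtr1 ler_sqrt//.
      have [->|n0] := eqVneq n 0%N; first by rewrite mul0r.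
      by rewrite divff// pnatr_eq0.
    by split=> //; split=> //; rewrite (le_lt_trans normT)// ltry.
  have normI := L2_norm_cst (@vnorm_test_image R n).
  rewrite (@L2_norm_paraproduct _ _ _ _ (@test_image R n) n.*2).
  + rewrite normI lee_fin.
    have ln0 : 0 <= ln (n + 1)%:R :> R by rewrite ln_ge0// ler1n addn1.
    (* The factor 4 is the constant of the logarithmic growth of the row sums,
       the factor 2 the normalization of the symbol. *)
    rewrite (_ : 8^-1 * _ = (ln (n + 1)%:R / 4) / 2); last by field.
    rewrite ler_pM2r ?invr_gt0//.
    have [->|n0] := eqVneq n 0%N; first by rewrite ln1 mul0r sqrtr_ge0.
    rewrite -[leLHS]ger0_norm ?divr_ge0// -sqrtr_sqr ler_wsqrtr//.
    rewrite -ler_pdivrMl ?invr_gt0 ?ltr0n ?lt0n// invrK.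
    exact: hilbert_lower_unbounded.
  + by split=> //; rewrite normI ltry.
  + by move=> N z nN; exact: paraproduct_sum_hilbert.
Qed.
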